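(* Let $C_1,C_2,C_3\in\mathbb{R}^{2\times 2}$ be any matrices of rank one. For $\epsilon=(\epsilon_1,\epsilon_2,\epsilon_3)\in\{-1,+1\}^3$ let $X_\epsilon=\epsilon_1C_1+\epsilon_2C_2+\epsilon_3C_3$, written $X_{\pm\pm\pm}$ according to the signs of $\epsilon_1,\epsilon_2,\epsilon_3$. Then for every rank-one convex function $f:\mathbb{R}^{2\times 2}\to\mathbb{R}$, $$f(0)\leq\frac{1}{16}\bigl(f(X_{+++})+f(X_{+--})+f(X_{-+-})+f(X_{--+})\bigr)+\frac{3}{16}\bigl(f(X_{---})+f(X_{++-})+f(X_{+-+})+f(X_{-++})\bigr).$$
   Context: A function $f:\mathbb{R}^{2\times 2}\to\mathbb{R}$ is rank-one convex if for all $A,B\in\mathbb{R}^{2\times 2}$ with $\mathrm{rank}(B)=1$ the function $t\mapsto f(A+tB)$ is convex on $\mathbb{R}$. *)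

(* Defs.v *)
From HB Require Import structures.
From mathcomp Require Import all_boot all_order all_algebra.
From mathcomp Require Import classical_sets reals convex.

Set Implicit Arguments.
Unset Strict Implicit.
Unset Printing Implicit Defensive.

Import Order.TTheory GRing.Theory Num.Theory.
Local Open Scope ring_scope.

(* [convex_function] expects a function on an lmodType over R, so the real line
   enters as the regular module R^o. *)
Definition rank_one_convex (R : realType) (f : 'M[R]_2 -> R) : Prop :=
  forall A B : 'M[R]_2, \rank B = 1%N ->
    @convex_function R R^o setT (fun t : R => f (A + t *: B)).

Definition signed_sum (R : realType) (C1 C2 C3 : 'M[R]_2) (e1 e2 e3 : R) :
  'M[R]_2 := e1 *: C1 + e2 *: C2 + e3 *: C3.

(* Main.v *)
Require Import Defs.
From HB Require Import structures.
From mathcomp Require Import all_boot all_order all_algebra.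
From mathcomp Require Import classical_sets reals convex.
From mathcomp Require Import interval_inference ring lra.

(** Put g(x,y,z) = f(x C1 + y C2 + z C3). Since det C_i = 0, the determinant
    of x C1 + y C2 + z C3 is a quadratic form without squares,
    b1 yz + b2 zx + b3 xy, and all that is used of f is that g is convex along
    every direction in the null cone of this form. The coordinate axes alone
    would not suffice (g = xyz is convex along each axis and violates the
    inequality); the gain comes from the other null directions.

    Reduction to nonnegative functions. If g had a derivative at 0, subtracting
    the tangent plane would give a function h with h(0) = 0, hence h >= 0 on
    the whole null cone by convexity along the lines through 0, and only a
    finite linear problem about the values of h at the cube vertices would
    remain. A general g is treated by moving the origin: at a maximum point p
    of g - k |.|^2 over the cube, g is touched from above by a paraboloid, and
    a convex function of one variable touched from above by a smooth one has
    the same tangent. For large k the point p is close to 0, g(p) >= g(0), and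
    separate convexity controls the vertex values of the translated cube.
    Near-maxima are enough, at the price of errors that tend to 0:
    approximate_support, near_bound, null_convex_vertex_sum.

    The finite problem. Let h be convex along null directions and nonnegative
    on the part of the null cone inside the cube. A point of the cone on an
    edge of the cube gives an inequality between the two ends of this edge
    (edge_bound). A point of the cone on an axis is the midpoint of a null
    segment from a vertex to a point on an edge, which gives an inequality
    between three vertices (diagonal_bound). Changing the signs of two of the
    C_i, and of the form, makes all b_i nonnegative, with sum 1. The wanted
    inequality is a nonnegative combination of these two kinds of
    inequalities and their images under signed permutations of the
    coordinates. The combination depends on the b_i and on which of h(1,1,1),
    h(-1,-1,-1) is larger. If all b_i <= 1/2, the function of b_i that
    measures the contribution of one coordinate lies above its tangent
    3 - 7 b at the symmetric value b = 1/3, and these tangents add up to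
    exactly the required value (vertex_sum_ge0_small). If some b_i exceeds
    1/2, some of the edge points leave the cube, and other edges and diagonals
    take their place (vertex_sum_ge0_large). *)

Set Implicit Arguments.
Unset Strict Implicit.
Unset Printing Implicit Defensive.

Import Order.TTheory GRing.Theory Num.Theory.
Local Open Scope ring_scope.

(** * Convexity along the null cone of a quadratic form *)

(** The form is the determinant of u C1 + v C2 + w C3 when the C_i are singular;
    b1, b2, b3 are then the polarized determinants of the pairs opposite to the
    indices. *)
Definition null_direction (R : realType) (b1 b2 b3 u v w : R) : Prop :=
  b1 * (v * w) + b2 * (w * u) + b3 * (u * v) = 0.

(** Convexity in lever form: p divides the segment from p - s v to p + t v in
    the ratio s : t. Without denominators the degenerate cases s = 0 and t = 0
    need no separate treatment. *)
Definition null_convex (R : realType) (b1 b2 b3 : R) (g : R -> R -> R -> R) : Prop :=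
  forall x y z u v w s t, null_direction b1 b2 b3 u v w -> 0 <= s -> 0 <= t ->
    (s + t) * g x y z <= t * g (x - s * u) (y - s * v) (z - s * w)
                         + s * g (x + t * u) (y + t * v) (z + t * w).

(** What is left of a null-convex function after subtracting its tangent plane
    at the origin: zero is then a lower bound along the null cone. *)
Definition supported (R : realType) (b1 b2 b3 : R) (h : R -> R -> R -> R) : Prop :=
  null_convex b1 b2 b3 h /\
  forall u v w, null_direction b1 b2 b3 u v w ->
    -1 <= u <= 1 -> -1 <= v <= 1 -> -1 <= w <= 1 -> 0 <= h u v w.

(** Sixteen times the right-hand side of the inequality. *)
Definition vertex_sum (R : realType) (g : R -> R -> R -> R) : R :=
  (g 1 1 1 + g 1 (-1) (-1) + g (-1) 1 (-1) + g (-1) (-1) 1)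
  + 3 * (g (-1) (-1) (-1) + g 1 1 (-1) + g 1 (-1) 1 + g (-1) 1 1).

Lemma null_convex_lever (R : realType) (b1 b2 b3 : R) (g : R -> R -> R -> R)
    (x y z u v w s t x' y' z' x'' y'' z'' : R) :
  null_convex b1 b2 b3 g -> null_direction b1 b2 b3 u v w -> 0 <= s -> 0 <= t ->
  x' = x - s * u -> y' = y - s * v -> z' = z - s * w ->
  x'' = x + t * u -> y'' = y + t * v -> z'' = z + t * w ->
  (s + t) * g x y z <= t * g x' y' z' + s * g x'' y'' z''.
Proof. by move=> hg n s0 t0 -> -> -> -> -> ->; apply: hg. Qed.

(** Linear changes of variables that preserve the cube and map one null cone
    into the other; all signed permutations of the coordinates below are
    instances. *)
Lemma supported_pullback (R : realType) (b1 b2 b3 c1 c2 c3 : R)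
    (h X Y Z : R -> R -> R -> R) :
  supported b1 b2 b3 h ->
  (forall L, (L = X) \/ (L = Y) \/ (L = Z) -> forall x y z u v w k,
     L (x + k * u) (y + k * v) (z + k * w) = L x y z + k * L u v w) ->
  (forall L, (L = X) \/ (L = Y) \/ (L = Z) -> forall u v w : R,
     -1 <= u <= 1 -> -1 <= v <= 1 -> -1 <= w <= 1 -> -1 <= L u v w <= 1) ->
  (forall u v w, null_direction c1 c2 c3 u v w ->
     null_direction b1 b2 b3 (X u v w) (Y u v w) (Z u v w)) ->
  supported c1 c2 c3 (fun x y z => h (X x y z) (Y x y z) (Z x y z)).
Proof.
move=> [hc h0] lin cube null; split=> [x y z u v w s t n s0 t0|u v w n hu hv hw].
  have linB L (hL : (L = X) \/ (L = Y) \/ (L = Z)) :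
      L (x - s * u) (y - s * v) (z - s * w) = L x y z - s * L u v w.
    by rewrite -!mulNr lin.
  by apply: (null_convex_lever hc (null _ _ _ n) s0 t0);
    (apply: linB || apply: lin); auto.
apply: h0; first exact: null.
all: by apply: cube => //; auto.
Qed.

Ltac pullback := apply: supported_pullback;
  [eassumption
  | by move=> L [->|[->|->]] *; ring
  | by move=> L [->|[->|->]] *; lra
  | rewrite /null_direction => u v w; lra ].

Lemma supported_cycle (R : realType) (b1 b2 b3 : R) (h : R -> R -> R -> R) :
  supported b1 b2 b3 h -> supported b2 b3 b1 (fun x y z => h z x y).
Proof. by move=> hh; pullback. Qed.

Lemma supported_opp (R : realType) (b1 b2 b3 : R) (h : R -> R -> R -> R) :
  supported b1 b2 b3 h -> supported b1 b2 b3 (fun x y z => h (- x) (- y) (- z)).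
Proof. by move=> hh; pullback. Qed.

(** * Inequalities between vertices from points of the null cone *)

(** The point (-r,1,1) with r = b1/(b2+b3) lies on the null cone and on an edge
    of the cube; h is nonnegative there and convex along the edge. The b_i may
    have any sign, so that signed permutations reach all the edges. *)
Lemma edge_bound (R : realType) (b1 b2 b3 : R) (h : R -> R -> R -> R) :
  supported b1 b2 b3 h -> - (b2 + b3) <= b1 -> b1 <= b2 + b3 ->
  0 <= (b2 + b3 - b1) * h 1 1 1 + (b1 + b2 + b3) * h (-1) 1 1.
Proof.
move=> [hc h0] l1 l2.
have [c0|c_gt0] := leP (b2 + b3) 0.
  have -> : b2 + b3 - b1 = 0 by lra.
  have -> : b1 + b2 + b3 = 0 by lra.
  by rewrite !mul0r addr0.
have c_neq0 : b2 + b3 != 0 by rewrite gt_eqF.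
pose r := b1 / (b2 + b3).
have rE : b1 = r * (b2 + b3) by rewrite /r divfK.
have r1 : -1 <= r <= 1.
  by rewrite /r ler_pdivlMr // ler_pdivrMr //; lra.
have hp : 0 <= h (- r) 1 1.
  by apply: h0; rewrite ?/null_direction ?rE; lra.
have : (1 - r + (1 + r)) * h (- r) 1 1 <= (1 + r) * h (-1) 1 1 + (1 - r) * h 1 1 1.
  apply: (null_convex_lever (u := 1) (v := 0) (w := 0) hc);
    rewrite /null_direction; lra.
move=> hle.
have hm : 0 <= (1 + r) * h (-1) 1 1 + (1 - r) * h 1 1 1 by lra.
have := mulr_ge0 (ltW c_gt0) hm; rewrite rE; lra.
Qed.

(** With r = b1/(b2+b3), the null direction (-r,1,1) through the axis point
    (r-1,0,0) leads to the vertex (-1,1,1) on one side and to (2r-1,-1,-1), on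
    an edge, on the other. *)
Lemma diagonal_bound (R : realType) (b1 b2 b3 : R) (h : R -> R -> R -> R) :
  supported b1 b2 b3 h -> 0 <= b1 -> b1 <= b2 + b3 ->
  0 <= (b2 + b3) * h (-1) 1 1 + (b2 + b3 - b1) * h (-1) (-1) (-1) + b1 * h 1 (-1) (-1).
Proof.
move=> [hc h0] l1 l2.
have [c0|c_gt0] := leP (b2 + b3) 0.
  have -> : b1 = 0 by lra.
  have -> : b2 + b3 = 0 by lra.
  by lra.
have c_neq0 : b2 + b3 != 0 by rewrite gt_eqF.
pose r := b1 / (b2 + b3).
have rE : b1 = r * (b2 + b3) by rewrite /r divfK.
have r1 : 0 <= r <= 1.
  by rewrite /r ler_pdivlMr // ler_pdivrMr //; lra.
have hp : 0 <= h (r - 1) 0 0.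
  by apply: h0; rewrite ?/null_direction ?rE; lra.
have hle : (1 + 1) * h (r - 1) 0 0 <= 1 * h (2 * r - 1) (-1) (-1) + 1 * h (-1) 1 1.
  apply: (null_convex_lever (u := (- r)) (v := 1) (w := 1) hc);
    rewrite /null_direction ?rE; lra.
have hle' : (2 * r + (2 - 2 * r)) * h (2 * r - 1) (-1) (-1)
    <= (2 - 2 * r) * h (-1) (-1) (-1) + 2 * r * h 1 (-1) (-1).
  apply: (null_convex_lever (u := 1) (v := 0) (w := 0) hc);
    rewrite /null_direction; lra.
have hm : 0 <= h (-1) 1 1 + (1 - r) * h (-1) (-1) (-1) + r * h 1 (-1) (-1) by lra.
have := mulr_ge0 (ltW c_gt0) hm; rewrite rE; lra.
Qed.

(** The bounds for the first coordinate: they relate the vertices (-1,1,1) and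
    (1,-1,-1) to the two vertices (1,1,1) and (-1,-1,-1), which play this part
    for every coordinate. *)
Lemma hub_bounds (R : realType) (b1 b2 b3 : R) (h : R -> R -> R -> R) :
  supported b1 b2 b3 h -> b1 + b2 + b3 = 1 -> 0 <= b1 <= 2^-1 ->
  [/\ 0 <= (1 - 2 * b1) * h 1 1 1 + h (-1) 1 1,
      0 <= (1 - 2 * b1) * h (-1) (-1) (-1) + h 1 (-1) (-1)
    & 0 <= (1 - b1) * h (-1) 1 1 + (1 - 2 * b1) * h (-1) (-1) (-1)
           + b1 * h 1 (-1) (-1)].
Proof.
move=> hh S hb.
have b23 : b2 + b3 = 1 - b1 by lra.
have := edge_bound hh; rewrite S b23 mul1r => e1.
have := edge_bound (supported_opp hh); rewrite S b23 mul1r !opprK => e2.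
have := diagonal_bound hh; rewrite b23 => e3.
have l1 : - (1 - b1) <= b1 by lra.
have l2 : b1 <= 1 - b1 by lra.
have l0 : 0 <= b1 by lra.
by split; [have := e1 l1 l2 | have := e2 l1 l2 | have := e3 l0 l2]; lra.
Qed.

(** * Nonnegativity of the vertex sum when no coefficient exceeds one half *)

(** Here X, Y, f, g are the values at (1,1,1), (-1,-1,-1), (-1,1,1),
    (1,-1,-1). The best combination of the three bounds that yields 3 f + g
    gains m(b) (X - Y) over the one without the third bound, with
    m(b) = 3 (1 - 2b) for b <= 1/4 and (1 - 2b)(1 - b)/b for b >= 1/4; the
    factor 3 - 7b is the tangent of m at b = 1/3. Being affine in b, it can be
    summed over the three coordinates, where only the sum of the b_i is known. *)
Lemma small_hub_bound (R : realType) (b X Y f g : R) : 0 <= b <= 2^-1 -> Y <= X ->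
  0 <= (1 - 2 * b) * X + f -> 0 <= (1 - 2 * b) * Y + g ->
  0 <= (1 - b) * f + (1 - 2 * b) * Y + b * g ->
  (3 - 7 * b) * (X - Y) - (1 - 2 * b) * (3 * X + Y) <= 3 * f + g.
Proof.
move=> hb YX A B C.
have XY : 0 <= X - Y by lra.
have b0 : 0 <= b by lra.
(* Starting from 3 A + B, as much as possible is replaced by C: all of 3 A
   for b <= 1/4, all of B beyond. *)
have [b4|b4] := leP b (4^-1).
  have h1 : 0 <= 1 - 4 * b by lra.
  have := mulr_ge0 h1 B; have := mulr_ge0 b0 XY => m1 m2.
  have b1 : 0 < 1 - b by lra.
  have : 0 <= (1 - b) * (3 * f + g + 4 * (1 - 2 * b) * Y) by lra.
  by rewrite pmulr_rge0 // => m3; lra.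
have h1 : 0 <= 4 * b - 1 by lra.
have := mulr_ge0 h1 A; have := mulr_ge0 (sqr_ge0 (1 - 3 * b)) XY => m1 m2.
have b1 : 0 < b by lra.
rewrite -subr_ge0 -(pmulr_rge0 _ b1); lra.
Qed.

Lemma vertex_sum_ge0_small (R : realType) (b1 b2 b3 : R) (h : R -> R -> R -> R) :
  supported b1 b2 b3 h -> b1 + b2 + b3 = 1 ->
  0 <= b1 <= 2^-1 -> 0 <= b2 <= 2^-1 -> 0 <= b3 <= 2^-1 -> 0 <= vertex_sum h.
Proof.
move=> hh S h1 h2 h3.
have S2 : b2 + b3 + b1 = 1 by lra.
have S3 : b3 + b1 + b2 = 1 by lra.
have hh2 := supported_cycle hh.
have [A1 B1 C1] := hub_bounds hh S h1.
have [A2 B2 C2] := hub_bounds hh2 S2 h2.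
have [A3 B3 C3] := hub_bounds (supported_cycle hh2) S3 h3.
rewrite /vertex_sum.
have e3 : b3 = 1 - b1 - b2 by lra.
(* For X <= Y the combination of 3 A and B for every coordinate suffices. *)
have [XY|YX] := leP (h 1 1 1) (h (-1) (-1) (-1)).
  by rewrite e3 in A3 B3; lra.
have k1 := small_hub_bound h1 (ltW YX) A1 B1 C1.
have k2 := small_hub_bound h2 (ltW YX) A2 B2 C2.
have k3 := small_hub_bound h3 (ltW YX) A3 B3 C3.
by rewrite e3 in k3; lra.
Qed.

(** * Nonnegativity of the vertex sum when one coefficient dominates *)

(** The edges at (-1,1,1) parallel to the second and third axes meet the null
    cone: edge_bound for two signed permutations, whose coefficients are no
    longer all nonnegative. *)
Lemma large_edge_bounds (R : realType) (b1 b2 b3 : R) (h : R -> R -> R -> R) :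
  supported b1 b2 b3 h -> 0 <= b2 -> 0 <= b3 -> b2 + b3 <= b1 ->
  0 <= (b1 - b2 + b3) * h (-1) 1 1 + (b1 - b2 - b3) * h (-1) 1 (-1) /\
  0 <= (b1 + b2 - b3) * h (-1) 1 1 + (b1 - b2 - b3) * h (-1) (-1) 1.
Proof.
move=> hh p0 q0 hb; split.
  have hh' : supported (- b3) b1 (- b2) (fun x y z => h (- y) z x) by pullback.
  by have := edge_bound hh' ltac:(lra) ltac:(lra); lra.
have hh' : supported (- b2) (- b3) b1 (fun x y z => h (- z) x y) by pullback.
by have := edge_bound hh' ltac:(lra) ltac:(lra); lra.
Qed.

(** The null segments of diagonal_bound, moved by signed permutations so that
    they start at (-1,1,1) and cross the second and the third axis; they stay
    in the cube because b1 dominates. *)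
Lemma large_diagonal_bounds (R : realType) (b1 b2 b3 : R) (h : R -> R -> R -> R) :
  supported b1 b2 b3 h -> 0 <= b2 -> 0 <= b3 -> b2 + b3 <= b1 ->
  0 <= (b1 - b3) * h (-1) 1 1 + (b1 - b2 - b3) * h 1 1 (-1) + b2 * h 1 (-1) (-1) /\
  0 <= (b1 - b2) * h (-1) 1 1 + (b1 - b2 - b3) * h 1 (-1) 1 + b3 * h 1 (-1) (-1).
Proof.
move=> hh p0 q0 hb; split.
  have hh' : supported b2 b1 (- b3) (fun x y z => h (- y) (- x) z) by pullback.
  by have := diagonal_bound hh' ltac:(lra) ltac:(lra); rewrite !opprK; lra.
have hh' : supported b3 b1 (- b2) (fun x y z => h (- y) z (- x)) by pullback.
by have := diagonal_bound hh' ltac:(lra) ltac:(lra); rewrite !opprK; lra.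
Qed.

(** As a quadratic in p the expression has no positive discriminant; completing
    the square with the factor 2 + 6s leaves s times a polynomial in s alone,
    positive on [0,1/2]. *)
Lemma large_hub_quadratic (R : realType) (p s : R) : 0 <= s <= 2^-1 ->
  0 <= s * (1 - 2 * p) * (6 * s ^+ 2 - 3 * s + 1 - 4 * p) + 2 * p ^+ 2 * (1 - s).
Proof.
move=> hs.
have l0 : 0 < 2 + 6 * s by lra.
have s0 : 0 <= s by lra.
have t0 : 0 <= 1 - 2 * s by lra.
have r0 : 0 <= - 9 * s ^+ 3 * (1 - 2 * s) ^+ 2 + 12 * s ^+ 2 - 9 * s + 2.
  have q0 : 0 <= s * (1 - 2 * s) by apply: mulr_ge0.
  have q1 : s * (1 - 2 * s) <= 8^-1.
    by have := sqr_ge0 (s - 4^-1); lra.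
  have q2 : (s * (1 - 2 * s)) ^+ 2 <= 8^-1 * 8^-1.
    by rewrite expr2; apply: ler_pM.
  have q3 : s * (s * (1 - 2 * s)) ^+ 2 <= 2^-1 * (8^-1 * 8^-1).
    by apply: ler_pM => //; [apply: sqr_ge0 | lra].
  have := sqr_ge0 (s - 3 / 8); lra.
rewrite -(pmulr_rge0 _ l0).
have := mulr_ge0 s0 r0.
have := sqr_ge0 ((2 + 6 * s) * p - 3 * s * (2 * s ^+ 2 - s + 1)).
lra.
Qed.

(** The analogue of small_hub_bound for one of the two small coefficients p,
    with s the sum of both. The weights 4 - K and K of f and g are what the
    bounds that do not involve X and Y leave over in vertex_sum_ge0_large. The
    choice d = p/s of the loss makes the total loss of the two coefficients
    equal to 1, which is exactly what can be afforded; stating it as d s = p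
    covers s = 0. *)
Lemma large_hub_bound (R : realType) (p s d X Y f g : R) :
  let K := 6 * s ^+ 2 - 3 * s + 1 in
  0 <= p -> p <= s -> s <= 2^-1 -> 0 <= d -> d * s = p -> Y <= X ->
  0 <= (1 - 2 * p) * X + f -> 0 <= (1 - 2 * p) * Y + g ->
  0 <= (1 - p) * f + (1 - 2 * p) * Y + p * g ->
  0 <= (4 - K) * f + K * g + 4 * (1 - 2 * p) * Y + 2 * (1 - s) * d * (X - Y).
Proof.
move=> K p0 ps s1 d0 ds YX A B C.
have XY : 0 <= X - Y by lra.
have hs : 0 <= s <= 2^-1 by lra.
have s1' : 0 <= 1 - s by lra.
have K0 : 0 <= K by have := sqr_ge0 (s - 4^-1); rewrite /K; lra.
have K1 : K <= 1.
  have s0 : 0 <= s by lra.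
  have t0 : 0 <= 1 - 2 * s by lra.
  by have := mulr_ge0 s0 t0; rewrite /K; lra.
have H := large_hub_quadratic p hs; rewrite -/K in H.
(* C is used until one of A, B is exhausted: combine (4-K) C with B, or K C
   with A. *)
have [pK|Kp] := leP (4 * p) K.
  have c1 : 0 <= 4 - K by lra.
  have c2 : 0 <= K - 4 * p by lra.
  have := mulr_ge0 c1 C; have := mulr_ge0 c2 B => m1 m2.
  have c3 : 0 < 1 - p by lra.
  have m3 : 0 <= (4 - K) * f + K * g + 4 * (1 - 2 * p) * Y.
    by rewrite -(pmulr_rge0 _ c3); lra.
  by have := mulr_ge0 (mulr_ge0 s1' d0) XY; lra.
have p1 : 0 < p by lra.
have s2 : 0 < s by lra.
have c2 : 0 <= 4 * p - K by lra.
have := mulr_ge0 K0 C; have := mulr_ge0 c2 A => m1 m2.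
have m3 : 0 <= 2 * (1 - s) * d * p - (1 - 2 * p) * (4 * p - K).
  by rewrite -(pmulr_rge0 _ s2); move: H; rewrite -ds; lra.
by rewrite -(pmulr_rge0 _ p1); have := mulr_ge0 m3 XY; lra.
Qed.

(** With s = b2 + b3, 2(1-s) times the vertex sum is split in two parts.
    The first collects f1, g1 and the bounds at the edges and diagonals that
    exist because b1 is large; its multipliers 2(1-s), 1-s and 1+3s are those
    that give f1 and g1 their final weights 3 and 1. The rest contains
    X = h(1,1,1), Y = h(-1,-1,-1) and what remains of the other vertices,
    and is handled by the hub bounds for the two small coefficients. *)
Lemma vertex_sum_ge0_large (R : realType) (b1 b2 b3 : R) (h : R -> R -> R -> R) :
  supported b1 b2 b3 h -> b1 + b2 + b3 = 1 -> 2^-1 <= b1 -> 0 <= b2 -> 0 <= b3 ->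
  0 <= vertex_sum h.
Proof.
move=> hh S h1 p0 q0.
have h2 : 0 <= b2 <= 2^-1 by lra.
have h3 : 0 <= b3 <= 2^-1 by lra.
have S2 : b2 + b3 + b1 = 1 by lra.
have S3 : b3 + b1 + b2 = 1 by lra.
have hb : b2 + b3 <= b1 by lra.
have hh2 := supported_cycle hh.
have [A2 B2 C2] := hub_bounds hh2 S2 h2.
have [A3 B3 C3] := hub_bounds (supported_cycle hh2) S3 h3.
have [U2 U3] := large_edge_bounds hh p0 q0 hb.
have [V2 V3] := large_edge_bounds (supported_opp hh) p0 q0 hb.
have [E2 E3] := large_diagonal_bounds hh p0 q0 hb.
rewrite ?opprK in V2 V3.
have b1E : b1 = 1 - b2 - b3 by lra.
rewrite /vertex_sum.
move: (h 1 1 1) (h (-1) (-1) (-1)) (h (-1) 1 1) (h 1 (-1) 1) (h 1 1 (-1))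
  (h 1 (-1) (-1)) (h (-1) 1 (-1)) (h (-1) (-1) 1)
  A2 B2 C2 A3 B3 C3 U2 U3 V2 V3 E2 E3
  => X Y f1 f2 f3 g1 g2 g3 A2 B2 C2 A3 B3 C3 U2 U3 V2 V3 E2 E3.
pose s := b2 + b3.
pose K := 6 * s ^+ 2 - 3 * s + 1.
have s0 : 0 <= s by rewrite /s; lra.
have s1 : s <= 2^-1 by rewrite /s; lra.
have s1' : 0 < 1 - s by lra.
have s3 : 0 <= 1 + 3 * s by lra.
have K0 : 0 <= K by have := sqr_ge0 (s - 4^-1); rewrite /K; lra.
have K1 : K <= 1.
  have t0 : 0 <= 1 - 2 * s by lra.
  by have := mulr_ge0 s0 t0; rewrite /K; lra.
have far : 0 <= 2 * (1 - s) * (3 * f1 + g1) + 3 * (1 - s) * (1 - 2 * s) * (f2 + f3)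
             + (1 + 3 * s) * (1 - 2 * s) * (g2 + g3).
  have := mulr_ge0 (ltW s1') (addr_ge0 E2 E3).
  have := mulr_ge0 (ltW s1') (addr_ge0 V2 V3).
  have := mulr_ge0 s3 (addr_ge0 U2 U3).
  by rewrite b1E /s; lra.
have near : 0 <= 2 * (1 - s) * (X + 3 * Y) + (4 - K) * (f2 + f3) + K * (g2 + g3).
  have [XY|/ltW YX] := leP X Y.
    have k4 : 0 <= 4 - K by lra.
    have k3 : 0 <= 3 - K by lra.
    have := mulr_ge0 k4 (addr_ge0 A2 A3).
    have := mulr_ge0 K0 (addr_ge0 B2 B3).
    have yx : 0 <= Y - X by lra.
    have := mulr_ge0 (mulr_ge0 (ltW s1') k3) yx.
    by rewrite /s; lra.
  have [d2 [d3 [d20 d30 d2s d3s d23]]] : exists d2 d3,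
      [/\ 0 <= d2, 0 <= d3, d2 * s = b2, d3 * s = b3 & d2 + d3 = 1].
    have [sz|sn0] := eqVneq s 0.
      have [-> ->] : b2 = 0 /\ b3 = 0 by rewrite /s in sz; split; lra.
      by exists 2^-1, 2^-1; rewrite sz !mulr0; split=> //; lra.
    exists (b2 / s), (b3 / s).
    split; rewrite ?divr_ge0 ?divfK // -mulrDl divff //.
  have ps : b2 <= s by rewrite /s; lra.
  have qs : b3 <= s by rewrite /s; lra.
  have := large_hub_bound p0 ps s1 d20 d2s YX A2 B2 C2.
  have := large_hub_bound q0 qs s1 d30 d3s YX A3 B3 C3.
  rewrite -/K; have -> : d3 = 1 - d2 by lra.
  have -> : b3 = s - b2 by rewrite /s; lra.
  by lra.
by rewrite -(pmulr_rge0 _ s1'); rewrite /K in near; lra.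
Qed.

(** * Reduction to nonnegative coefficients of sum one *)

Lemma supported_scale (R : realType) (k b1 b2 b3 : R) (h : R -> R -> R -> R) :
  k != 0 -> supported b1 b2 b3 h -> supported (k * b1) (k * b2) (k * b3) h.
Proof.
move=> k0 [hc h0].
have null u v w : null_direction (k * b1) (k * b2) (k * b3) u v w ->
    null_direction b1 b2 b3 u v w.
  rewrite /null_direction -!mulrA -!mulrDr => /eqP.
  by rewrite mulf_eq0 (negPf k0) => /eqP.
split=> [x y z u v w s t /null n|u v w /null n]; [exact: hc | exact: h0].
Qed.

Lemma vertex_sum_cycle (R : realType) (h : R -> R -> R -> R) :
  vertex_sum (fun x y z => h z x y) = vertex_sum h.
Proof. by rewrite /vertex_sum; ring. Qed.

Lemma vertex_sum_ge0_nneg (R : realType) (b1 b2 b3 : R) (h : R -> R -> R -> R) :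
  supported b1 b2 b3 h -> 0 <= b1 -> 0 <= b2 -> 0 <= b3 -> 0 <= vertex_sum h.
Proof.
wlog S : b1 b2 b3 / b1 + b2 + b3 = 1 => [unit hh p1 p2 p3|].
  have [S0|S0] := eqVneq (b1 + b2 + b3) 0.
    have [z1 z2 z3] : [/\ b1 = 0, b2 = 0 & b3 = 0] by split; lra.
    have [_ h0] := hh.
    have v0 x y z : -1 <= x <= 1 -> -1 <= y <= 1 -> -1 <= z <= 1 -> 0 <= h x y z.
      by apply: h0; rewrite /null_direction z1 z2 z3; lra.
    by rewrite /vertex_sum !(addr_ge0, mulr_ge0, v0) //; lra.
  have Sp : 0 <= (b1 + b2 + b3)^-1 by rewrite invr_ge0; lra.
  apply: unit (supported_scale (invr_neq0 S0) hh) _ _ _;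
    [by rewrite -!mulrDr mulVf | exact: mulr_ge0..].
have [l1|/ltW m1] := leP (2^-1) b1.
  by move=> hh _ p2 p3; apply: vertex_sum_ge0_large hh S l1 p2 p3.
have [l2|/ltW m2] := leP (2^-1) b2.
  move=> hh p1 p2 p3; rewrite -vertex_sum_cycle.
  by apply: vertex_sum_ge0_large (supported_cycle hh) _ l2 p3 p1; lra.
have [l3|/ltW m3] := leP (2^-1) b3.
  move=> hh p1 p2 p3; rewrite -vertex_sum_cycle -vertex_sum_cycle.
  apply: vertex_sum_ge0_large
    (supported_cycle (supported_cycle hh)) _ l3 p1 p2; lra.
by move=> hh p1 p2 p3; apply: vertex_sum_ge0_small hh S _ _ _; apply/andP.
Qed.

Lemma supported_flip (R : realType) (b1 b2 b3 : R) (h : R -> R -> R -> R) :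
  supported b1 b2 b3 h -> supported b1 (- b2) (- b3) (fun x y z => h x (- y) (- z)).
Proof. by move=> hh; pullback. Qed.

Lemma vertex_sum_flip (R : realType) (h : R -> R -> R -> R) :
  vertex_sum (fun x y z => h x (- y) (- z)) = vertex_sum h.
Proof. by rewrite /vertex_sum !opprK; ring. Qed.

(** The vertex sum distinguishes the even vertices from the odd ones, so only an
    even number of coordinates may be reversed. That is enough, because the
    form may also be negated: if the signs differ, one coefficient differs
    from the two others. *)
Lemma vertex_sum_ge0 (R : realType) (b1 b2 b3 : R) (h : R -> R -> R -> R) :
  supported b1 b2 b3 h -> 0 <= vertex_sum h.
Proof.
have one (c1 c2 c3 : R) k : supported c1 c2 c3 k -> 0 <= c1 -> c2 <= 0 -> c3 <= 0 ->
    0 <= vertex_sum k.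
  move=> hk p1 n2 n3; rewrite -vertex_sum_flip.
  by apply: vertex_sum_ge0_nneg (supported_flip hk) p1 _ _; rewrite oppr_ge0.
have neg (c1 c2 c3 : R) k : supported c1 c2 c3 k -> supported (- c1) (- c2) (- c3) k.
  rewrite -[- c1]mulN1r -[- c2]mulN1r -[- c3]mulN1r.
  by apply: supported_scale; rewrite oppr_eq0 oner_eq0.
have two (c1 c2 c3 : R) k : supported c1 c2 c3 k -> c1 <= 0 -> 0 <= c2 -> 0 <= c3 ->
    0 <= vertex_sum k.
  by move=> /neg hk n1 p2 p3; apply: one hk _ _ _; rewrite ?oppr_ge0 ?oppr_le0.
move=> hh; have hh2 := supported_cycle hh; have hh3 := supported_cycle hh2.
have e2 := vertex_sum_cycle h; have e3 := vertex_sum_cycle (fun x y z => h z x y).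
have [p1|/ltW n1] := leP 0 b1; have [p2|/ltW n2] := leP 0 b2;
  have [p3|/ltW n3] := leP 0 b3.
- exact: vertex_sum_ge0_nneg hh p1 p2 p3.
- by rewrite -e2 -e3; apply: two hh3 n3 p1 p2.
- by rewrite -e2; apply: two hh2 n2 p3 p1.
- exact: one hh p1 n2 n3.
- exact: two hh n1 p2 p3.
- by rewrite -e2; apply: one hh2 p2 n3 n1.
- by rewrite -e2 -e3; apply: one hh3 p3 n1 n2.
- by have hn := neg _ _ _ _ hh; apply: (vertex_sum_ge0_nneg hn); rewrite oppr_ge0.
Qed.

(** * Approximate tangent planes at nearby points *)

Lemma null_convex_cycle (R : realType) (b1 b2 b3 : R) (g : R -> R -> R -> R) :
  null_convex b1 b2 b3 g -> null_convex b2 b3 b1 (fun x y z => g z x y).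
Proof.
move=> hg x y z u v w s t n; apply: hg.
by move: n; rewrite /null_direction; lra.
Qed.

Lemma null_convex_shift (R : realType) (b1 b2 b3 : R) (g : R -> R -> R -> R) (a b c : R) :
  null_convex b1 b2 b3 g ->
  null_convex b1 b2 b3 (fun x y z => g (a + x) (b + y) (c + z)).
Proof. by move=> hg x y z u v w s t n s0 t0; rewrite !addrA; apply: hg. Qed.

Lemma axis_bound (R : realType) (b1 b2 b3 : R) (g : R -> R -> R -> R) (M x y z : R) :
  null_convex b1 b2 b3 g -> -1 <= x <= 1 ->
  g (-1) y z <= M -> g 1 y z <= M -> g x y z <= M.
Proof.
move=> hg hx m1 m2.
have : (1 + x + (1 - x)) * g x y z <= (1 - x) * g (-1) y z + (1 + x) * g 1 y z.
  by apply: (null_convex_lever (u := 1) (v := 0) (w := 0) hg);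
    rewrite /null_direction; lra.
have n1 : 0 <= 1 - x by lra.
have n2 : 0 <= 1 + x by lra.
have d1 : 0 <= M - g (-1) y z by lra.
have d2 : 0 <= M - g 1 y z by lra.
by have := mulr_ge0 n1 d1; have := mulr_ge0 n2 d2; lra.
Qed.

Lemma cube_bound (R : realType) (b1 b2 b3 : R) (g : R -> R -> R -> R) :
  null_convex b1 b2 b3 g ->
  exists M, forall x y z, -1 <= x <= 1 -> -1 <= y <= 1 -> -1 <= z <= 1 -> g x y z <= M.
Proof.
move=> hg.
have hg2 := null_convex_cycle hg.
have hg3 := null_convex_cycle hg2.
exists (`|g 1 1 1| + `|g 1 1 (-1)| + `|g 1 (-1) 1| + `|g 1 (-1) (-1)| + `|g (-1) 1 1|
        + `|g (-1) 1 (-1)| + `|g (-1) (-1) 1| + `|g (-1) (-1) (-1)|).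
move=> x y z hx hy hz.
have n0 i j k := normr_ge0 (g i j k).
have along2 M a c : g a (-1) c <= M -> g a 1 c <= M -> g a y c <= M.
  exact: (axis_bound (y := c) (z := a) hg2 hy).
have along3 M a c : g a c (-1) <= M -> g a c 1 <= M -> g a c z <= M.
  exact: (axis_bound (y := a) (z := c) hg3 hz).
apply: (axis_bound hg hx); apply: along2; apply: along3;
  by apply: le_trans (ler_norm _) _;
    have := n0 1 1 1; have := n0 1 1 (-1); have := n0 1 (-1) 1;
    have := n0 1 (-1) (-1); have := n0 (-1) 1 1; have := n0 (-1) 1 (-1);
    have := n0 (-1) (-1) 1; have := n0 (-1) (-1) (-1); lra.
Qed.

(** Upper semicontinuity along an axis, as the statement that the gap below an
    upper bound M shrinks at most by the factor 1 - e. *)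
Lemma axis_near (R : realType) (b1 b2 b3 : R) (g : R -> R -> R -> R) (M e x y z : R) :
  null_convex b1 b2 b3 g -> e <= 1 -> - e <= x <= e ->
  g (-1) y z <= M -> g 0 y z <= M -> g 1 y z <= M ->
  (1 - e) * (M - g 0 y z) <= M - g x y z.
Proof.
move=> hg e1 hx m1 m0 m2.
have d0 : 0 <= M - g 0 y z by lra.
have [x0|x0] := leP 0 x.
  have : (x + (1 - x)) * g x y z <= (1 - x) * g 0 y z + x * g 1 y z.
    by apply: (null_convex_lever (u := 1) (v := 0) (w := 0) hg);
      rewrite /null_direction; lra.
  have d2 : 0 <= M - g 1 y z by lra.
  have ex : 0 <= e - x by lra.
  by have := mulr_ge0 x0 d2; have := mulr_ge0 ex d0; lra.
have : (1 + x + - x) * g x y z <= (- x) * g (-1) y z + (1 + x) * g 0 y z.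
  by apply: (null_convex_lever (u := 1) (v := 0) (w := 0) hg);
    rewrite /null_direction; lra.
have d2 : 0 <= M - g (-1) y z by lra.
have ex : 0 <= e + x by lra.
have x0' : 0 <= - x by lra.
by have := mulr_ge0 x0' d2; have := mulr_ge0 ex d0; lra.
Qed.

Lemma near_bound (R : realType) (b1 b2 b3 : R) (g : R -> R -> R -> R) (M e x y z : R) :
  null_convex b1 b2 b3 g ->
  (forall x y z, -1 <= x <= 1 -> -1 <= y <= 1 -> -1 <= z <= 1 -> g x y z <= M) ->
  e <= 1 -> - e <= x <= e -> - e <= y <= e -> - e <= z <= e ->
  g x y z <= g 0 0 0 + 3 * e * (M - g 0 0 0).
Proof.
move=> hg hM e1 hx hy hz.
have hg2 := null_convex_cycle hg.
have hg3 := null_convex_cycle hg2.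
have a1 : (1 - e) * (M - g 0 y z) <= M - g x y z.
  by apply: (axis_near hg e1 hx); apply: hM; lra.
have a2 : (1 - e) * (M - g 0 0 z) <= M - g 0 y z.
  by apply: (axis_near (y := z) (z := 0) hg2 e1 hy); apply: hM; lra.
have a3 : (1 - e) * (M - g 0 0 0) <= M - g 0 0 z.
  by apply: (axis_near (y := 0) (z := 0) hg3 e1 hz); apply: hM; lra.
have d : 0 <= M - g 0 0 0 by rewrite subr_ge0; apply: hM; lra.
have e0 : 0 <= e by lra.
have e1' : 0 <= 1 - e by lra.
have a4 := ler_wpM2l e1' (le_trans (ler_wpM2l e1' a3) a2).
have : 0 <= e ^+ 2 * (3 - e) * (M - g 0 0 0).
  by rewrite !mulr_ge0 ?sqr_ge0 //; lra.
by lra.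
Qed.

(** The point (x,y,z) nearly maximizes g - k |.|^2 over the cube, and (l1,l2,l3)
    is the gradient of the touching paraboloid. For a null direction v,
    convexity at p between p - t v and p + v turns the upper bound at p - t v
    into a lower bound at p + v, with an error of order k t + a/t, where a is
    the defect of the near-maximum. *)
Lemma approximate_support (R : realType) (b1 b2 b3 : R) (g : R -> R -> R -> R) (e : R) :
  null_convex b1 b2 b3 g -> 0 < e -> e <= 2^-1 ->
  exists x y z l1 l2 l3 : R,
    [/\ - e <= x <= e, - e <= y <= e, - e <= z <= e, g 0 0 0 <= g x y z + e
      & forall u v w, null_direction b1 b2 b3 u v w ->
          -1 <= u <= 1 -> -1 <= v <= 1 -> -1 <= w <= 1 ->
          g x y z + (l1 * u + l2 * v + l3 * w) <= g (x + u) (y + v) (z + w) + e].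
Proof.
move=> hg e0 e2.
have [M hM] := cube_bound hg.
have M0 : g 0 0 0 <= M by apply: hM; lra.
(* Comparing a near-maximizer with 0 gives k |p|^2 <= M - g(0) + 1, so this k
   forces |p| <= e. *)
pose k := (M - g 0 0 0 + 1) / e ^+ 2.
have ek : k * e ^+ 2 = M - g 0 0 0 + 1 by rewrite /k divfK // sqrf_eq0 gt_eqF.
have k0 : 0 < k by apply: divr_gt0; [lra | exact: exprn_gt0].
(* The error 3 k t + a / t of the final estimate is then at most e. *)
pose t := e / (6 * (k + 1)).
have tk : t * (6 * (k + 1)) = e by rewrite /t divfK // gt_eqF //; lra.
have t0 : 0 < t by apply: divr_gt0 => //; lra.
have kt0 : 0 < k * t by apply: mulr_gt0.
pose a := t * e / 2.
have a0 : 0 < a by rewrite /a divr_gt0 // mulr_gt0.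
have a1 : a <= 1.
  have : t * e <= 1 * 1 by apply: ler_pM; lra.
  by rewrite /a; lra.
pose n x y z : R := x ^+ 2 + y ^+ 2 + z ^+ 2.
pose E : set R := [set r | exists x y z, [/\ -1 <= x <= 1, -1 <= y <= 1, -1 <= z <= 1
                            & r = g x y z - k * n x y z]]%classic.
have n0 x y z : 0 <= n x y z by rewrite /n !addr_ge0 ?sqr_ge0.
have ubE : ubound E M.
  move=> r [x [y [z [hx hy hz ->]]]].
  by have := mulr_ge0 (ltW k0) (n0 x y z); have := hM _ _ _ hx hy hz; lra.
have E0 : E (g 0 0 0).
  by exists 0, 0, 0; rewrite /n; split; lra.
have supE : has_sup E by split; [exists (g 0 0 0) | exists M].
have [r [x [y [z [hx hy hz rE]]]] rsup] := sup_adherent a0 supE.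
have near_max x' y' z' : -1 <= x' <= 1 -> -1 <= y' <= 1 -> -1 <= z' <= 1 ->
    g x' y' z' - k * n x' y' z' <= g x y z - k * n x y z + a.
  move=> hx' hy' hz'.
  have : g x' y' z' - k * n x' y' z' <= sup E.
    by apply: ub_le_sup; [exists M | exists x', y', z'].
  by rewrite -rE; lra.
have at0 : g 0 0 0 <= g x y z - k * n x y z + a.
  by have := near_max 0 0 0; rewrite {1}/n; lra.
have small : n x y z <= e ^+ 2.
  rewrite -(ler_pM2l k0) ek.
  by have := hM _ _ _ hx hy hz; lra.
have sqr_le (c : R) : c ^+ 2 <= e ^+ 2 -> - e <= c <= e.
  by rewrite -ler_norml -(real_normK (num_real c)) ler_sqr ?nnegrE ?(ltW e0).
have [hx' hy' hz'] : [/\ - e <= x <= e, - e <= y <= e & - e <= z <= e].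
  by split; apply: sqr_le; move: small; rewrite /n;
    have := sqr_ge0 x; have := sqr_ge0 y; have := sqr_ge0 z; lra.
exists x, y, z, (2 * k * x), (2 * k * y), (2 * k * z); split=> //.
  have := mulr_ge0 (ltW k0) (n0 x y z).
  have : t * e <= 1 * e by apply: ler_pM; lra.
  by move: at0; rewrite /a; lra.
move=> u v w nuvw hu hv hw.
have t1 : t <= 4^-1 by lra.
have in_cube (c d : R) : - e <= c <= e -> -1 <= d <= 1 -> -1 <= c - t * d <= 1.
  move=> hc hd.
  have d1 : 0 <= 1 - d by lra.
  have d2 : 0 <= 1 + d by lra.
  by have := mulr_ge0 (ltW t0) d1; have := mulr_ge0 (ltW t0) d2; lra.
have lever : (t + 1) * g x y z <= 1 * g (x - t * u) (y - t * v) (z - t * w)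
                                  + t * g (x + u) (y + v) (z + w).
  by apply: (null_convex_lever hg nuvw (ltW t0) ler01); rewrite ?mul1r.
have back := near_max _ _ _ (in_cube _ _ hx' hu) (in_cube _ _ hy' hv) (in_cube _ _ hz' hw).
have sq1 (d : R) : -1 <= d <= 1 -> 0 <= 1 - d ^+ 2.
  by rewrite -ler_norml subr_ge0 => hd; rewrite -(real_normK (num_real d)) expr_le1.
have nuv : 0 <= 3 - n u v w.
  by have := sq1 _ hu; have := sq1 _ hv; have := sq1 _ hw; rewrite /n; lra.
have te : t * e = 6 * (k * t * t) + 6 * t ^+ 2 by rewrite -{1}tk; ring.
rewrite -(ler_pM2l t0).
have := mulr_ge0 (ltW (mulr_gt0 kt0 t0)) nuv.
have := sqr_ge0 t.
by move: lever back; rewrite /n /a; lra.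
Qed.

(** The affine correction cancels in the vertex sum of h because the weights
    have total mass 16 and barycenter 0. *)
Lemma null_convex_vertex_sum (R : realType) (b1 b2 b3 : R) (g : R -> R -> R -> R) :
  null_convex b1 b2 b3 g -> 16 * g 0 0 0 <= vertex_sum g.
Proof.
move=> hg.
pose gX a b c : R -> R -> R -> R := fun x y z => g (a + x) (b + y) (c + z).
have hgX a b c : null_convex b1 b2 b3 (gX a b c) := null_convex_shift a b c hg.
have near a b c : exists2 D, 0 <= D & forall e x y z, e <= 1 ->
    - e <= x <= e -> - e <= y <= e -> - e <= z <= e ->
    g (x + a) (y + b) (z + c) <= g a b c + e * D.
  have [M hM] := cube_bound (hgX a b c).
  have M0 : g a b c <= M by have := hM 0 0 0; rewrite /gX !addr0; apply; lra.
  exists (3 * (M - g a b c)); first by lra.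
  move=> e x y z e1 hx hy hz.
  have := near_bound (hgX a b c) hM e1 hx hy hz.
  by rewrite /gX !addr0 ![_ + x]addrC ![_ + y]addrC ![_ + z]addrC; lra.
have [D1 D1p n1] := near 1 1 1.
have [D2 D2p n2] := near 1 (-1) (-1).
have [D3 D3p n3] := near (-1) 1 (-1).
have [D4 D4p n4] := near (-1) (-1) 1.
have [D5 D5p n5] := near (-1) (-1) (-1).
have [D6 D6p n6] := near 1 1 (-1).
have [D7 D7p n7] := near 1 (-1) 1.
have [D8 D8p n8] := near (-1) 1 1.
pose D := 32 + D1 + D2 + D3 + D4 + 3 * (D5 + D6 + D7 + D8).
have D0 : 0 < D by rewrite /D; lra.
(* 32 = 16 + 16: the errors in the comparison of g(0) with g(p) and in the
   support inequality. *)
suff close e : 0 < e -> e <= 2^-1 -> 16 * g 0 0 0 <= vertex_sum g + e * D.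
  apply/ler_addgt0Pr => r r0.
  have rD : 0 < r / D by apply: divr_gt0.
  have [l|l] := leP (r / D) 2^-1.
    by have := close _ rD l; rewrite divfK // gt_eqF.
  have := close (2^-1) ltac:(lra) (lexx _).
  by move: l; rewrite ltr_pdivlMr //; lra.
move=> e0 e2.
have [x [y [z [l1 [l2 [l3 [hx hy hz hp hs]]]]]]] := approximate_support hg e0 e2.
pose h u v w := g (x + u) (y + v) (z + w) - (g x y z + (l1 * u + l2 * v + l3 * w)) + e.
have hh : supported b1 b2 b3 h.
  split=> [a b c u v w s t n s0 t0|u v w n hu hv hw]; last first.
    by have := hs u v w n hu hv hw; rewrite /h; lra.
  by have := null_convex_shift x y z hg a b c n s0 t0; rewrite /h; lra.
have e1 : e <= 1 by lra.
have := vertex_sum_ge0 hh; rewrite /vertex_sum /h /D.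
have := n1 e x y z e1 hx hy hz; have := n2 e x y z e1 hx hy hz.
have := n3 e x y z e1 hx hy hz; have := n4 e x y z e1 hx hy hz.
have := n5 e x y z e1 hx hy hz; have := n6 e x y z e1 hx hy hz.
have := n7 e x y z e1 hx hy hz; have := n8 e x y z e1 hx hy hz.
by lra.
Qed.

(** * From matrices to coordinates *)

(** A singular 2 x 2 matrix has rank one unless it is zero, and then the
    inequality is trivial. *)
Lemma rank_one_convex_lever (R : realType) (f : 'M[R]_2 -> R) (A B : 'M[R]_2) (s t : R) :
  rank_one_convex f -> \det B = 0 -> 0 <= s -> 0 <= t ->
  (s + t) * f A <= t * f (A - s *: B) + s * f (A + t *: B).
Proof.
move=> hf dB s0 t0.
have [->|B0] := eqVneq B 0; first by rewrite !scaler0 subr0 addr0; lra.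
have rB : \rank B = 1%N.
  have : (0 < \rank B)%N by rewrite lt0n mxrank_eq0.
  have : ~~ row_free B by rewrite row_free_unit unitmxE dB unitr0.
  by rewrite /row_free; have := rank_leq_row B; case: (\rank B) => [|[|[|]]].
have [st0|st0] := leP (s + t) 0.
  have [-> ->] : s = 0 /\ t = 0 by split; lra.
  by lra.
have k0 : 0 <= t / (s + t) by apply: divr_ge0 => //; lra.
have k1 : t / (s + t) <= 1 by rewrite ler_pdivrMr // mul1r; lra.
have := hf A B rB (Itv01 k0 k1) (- s : R^o) (t : R^o).
rewrite !inE => /(_ I I); rewrite !convRE /= /conv /= /unstable.onem.
have kE : t / (s + t) * (s + t) = t by rewrite divfK // gt_eqF.
set k := t / (s + t) in kE *.
have -> : (k *: (- s : R^o) + (1 - k) *: (t : R^o)) = 0 :> R.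
  by rewrite /GRing.scale /=; lra.
rewrite scale0r addr0 scaleNr => hk.
rewrite -(ler_pM2l st0) in hk.
have ks : (1 - k) * (s + t) = s by lra.
by move: hk; rewrite mulrDr !(mulrCA (s + t)) !mulrA kE ks.
Qed.

Lemma det_mx22 (R : comNzRingType) (B : 'M[R]_2) :
  \det B = B 0 0 * B 1 1 - B 0 1 * B 1 0.
Proof.
rewrite (expand_det_row _ 0) !big_ord_recl big_ord0 addr0 /cofactor !det_mx11 !mxE /=.
have -> : lift 0 0 = 1 :> 'I_2 by apply/val_inj.
have -> : lift 1 0 = 0 :> 'I_2 by apply/val_inj.
by rewrite /bump /= expr0 expr1; ring.
Qed.

Theorem theorem1 (R : realType) (C1 C2 C3 : 'M[R]_2)
    (rC1 : \rank C1 = 1%N) (rC2 : \rank C2 = 1%N) (rC3 : \rank C3 = 1%N)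
    (f : 'M[R]_2 -> R) (hf : rank_one_convex f) :
  let X := signed_sum C1 C2 C3 in
  f 0 <= 1 / 16 * (f (X 1 1 1) + f (X 1 (-1) (-1))
                   + f (X (-1) 1 (-1)) + f (X (-1) (-1) 1))
         + 3 / 16 * (f (X (-1) (-1) (-1)) + f (X 1 1 (-1))
                     + f (X 1 (-1) 1) + f (X (-1) 1 1)).
Proof.
cbv zeta; set X := signed_sum C1 C2 C3.
have det0 (C : 'M[R]_2) : \rank C = 1%N -> \det C = 0.
  move=> rC; apply/eqP; rewrite -[_ == 0]negbK -unitfE -unitmxE -row_free_unit.
  by rewrite /row_free rC.
pose polar (A B : 'M[R]_2) :=
  A 0 0 * B 1 1 + B 0 0 * A 1 1 - A 0 1 * B 1 0 - B 0 1 * A 1 0.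
have detX x y z : \det (X x y z) =
    polar C2 C3 * (y * z) + polar C3 C1 * (z * x) + polar C1 C2 * (x * y).
  have := det0 _ rC1; have := det0 _ rC2; have := det0 _ rC3.
  rewrite !det_mx22 !mxE /polar => d3 d2 d1.
  transitivity ((C1 0 0 * C1 1 1 - C1 0 1 * C1 1 0) * x ^+ 2
     + (C2 0 0 * C2 1 1 - C2 0 1 * C2 1 0) * y ^+ 2
     + (C3 0 0 * C3 1 1 - C3 0 1 * C3 1 0) * z ^+ 2
     + (polar C2 C3 * (y * z) + polar C3 C1 * (z * x) + polar C1 C2 * (x * y))).
    by rewrite /polar; ring.
  by rewrite d1 d2 d3 !mul0r !add0r.
have XD x y z k u v w : X (x + k * u) (y + k * v) (z + k * w) = X x y z + k *: X u v w.
  by apply/matrixP => i j; rewrite !mxE; ring.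
have hg : null_convex (polar C2 C3) (polar C3 C1) (polar C1 C2)
    (fun x y z => f (X x y z)).
  move=> x y z u v w s t n s0 t0.
  rewrite -!mulNr !XD scaleNr; apply: rank_one_convex_lever => //.
  by rewrite detX.
have := null_convex_vertex_sum hg.
have -> : X 0 0 0 = 0 by rewrite /X /signed_sum !scale0r !addr0.
by rewrite /vertex_sum; lra.
Qed.
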